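(* For $0<\alpha<1$, let $\tilde{C}_S(\alpha)$ denote the Tauberian constant of the discrete strong maximal operator $\tilde{M}_S$ acting on functions on $\mathbb{Z}^n$. Then: (i) In dimensions $n\ge2$ we have $\tilde{C}_S\in C^{1/n}(0,1)$. (ii) In dimension $n=1$ we have $\tilde{C}_S\in C^\infty(0,1)$, with $\tilde{C}_S(\alpha)=\frac{2}{\alpha}-1$ for all $\alpha\in(0,1)$.
   Context: Discrete strong maximal operator: for $f$ on $\mathbb{Z}^n$ and $m\in\mathbb{Z}^n$, $$\tilde{M}_Sf(m)=\sup_{R\ni0}\frac{1}{\#(R\cap\mathbb{Z}^n)}\sum_{j\in R\cap\mathbb{Z}^n}|f(m+j)|,$$ where the supremum is over all open rectangles (rectangular parallelepipeds) $R\subset\mathbb{R}^n$ containing the origin with sides parallel to the coordinate axes. Its Tauberian constant is $$\tilde{C}_S(\alpha)=\sup_{E\subset\mathbb{Z}^n,\ 0<\#E<\infty}\frac{1}{\#E}\#\{m\in\mathbb{Z}^n: \tilde{M}_S\chi_E(m)>\alpha\},$$ where $\chi_E$ is the indicator function of $E$ and $\#$ denotes cardinality. H\''older class: for $0<p\le1$, $g\in C^p(0,1)$ means that $g$ is locally H\''older continuous of order $p$: for every compact $K\subset(0,1)$ there is a constant $c_K$ with $|g(\alpha)-g(\beta)|\le c_K|\alpha-\beta|^p$ for all $\alpha,\beta\in K$. *)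

(* Defs.v *)
From HB Require Import structures.
From mathcomp Require Import all_boot all_order all_algebra.
From mathcomp Require Import finmap.
From mathcomp Require Import all_classical all_reals all_analysis.
Set Implicit Arguments.
Unset Strict Implicit.
Unset Printing Implicit Defensive.
Import Order.TTheory GRing.Theory Num.Theory.
Import numFieldNormedType.Exports.
Local Open Scope classical_set_scope.
Local Open Scope ring_scope.

(* Points of R^n and Z^n are row vectors. *)
Definition open_rectangle (R : realType) (n : nat) (Q : set 'rV[R]_n) : Prop :=
  exists a b : 'rV[R]_n,
    Q = [set x : 'rV[R]_n | forall i : 'I_n, a 0 i < x 0 i < b 0 i].

Definition lattice_points (R : realType) (n : nat) (Q : set 'rV[R]_n) :
    set 'rV[int]_n :=
  [set j | Q (map_mx intr j)].

(* Rectangles are bounded, hence contain finitely many lattice points, so that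
   the cardinality and the sum below are the genuine ones. *)
Definition rectangle_average (R : realType) (n : nat) (f : 'rV[int]_n -> R)
    (m : 'rV[int]_n) (Q : set 'rV[R]_n) : R :=
  (#|` fset_set (lattice_points Q)|%:R)^-1 *
  \sum_(j \in lattice_points Q) `|f (m + j)|.

Definition strong_maximal (R : realType) (n : nat) (f : 'rV[int]_n -> R)
    (m : 'rV[int]_n) : \bar R :=
  ereal_sup [set (rectangle_average f m Q)%:E
            | Q in [set Q : set 'rV[R]_n | open_rectangle Q /\ Q 0]].

(* [counting A] is the number of elements of A, and +oo if A is infinite. The
   superlevel set is therefore not assumed finite, nor the supremum. *)
Definition tauberian_const (R : realType) (n : nat) (alpha : R) : \bar R :=
  ereal_sup
    [set (((fine (counting E : \bar R))^-1)%:E *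
          counting [set m : 'rV[int]_n
                   | alpha%:E < strong_maximal (\1_E : 'rV[int]_n -> R) m])%E
    | E in [set E : set 'rV[int]_n | (0 < (counting E : \bar R) < +oo)%E]].

Definition locally_hoelder (R : realType) (p : R) (U : set R) (g : R -> R) :
    Prop :=
  forall K : set R, compact K -> K `<=` U ->
    exists c : R, forall a b : R, K a -> K b ->
      `|g a - g b| <= c * `|a - b| `^ p.

(* For U open, the iterated derivatives at a point of U depend only on the
   values of g in U. *)
Definition smooth_on (R : realType) (U : set R) (g : R -> R) : Prop :=
  forall (k : nat) (x : R), U x -> derivable (g^`(k))%classic x 1.

(* Main.v *)
Require Import Defs.
From HB Require Import structures.
From mathcomp Require Import all_boot all_order all_algebra.
From mathcomp Require Import finmap.
From mathcomp Require Import all_classical all_reals all_analysis.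
From mathcomp Require Import lra ring zify.
Set Implicit Arguments.
Unset Strict Implicit.
Unset Printing Implicit Defensive.
Import Order.TTheory GRing.Theory Num.Theory.
Import numFieldNormedType.Exports.
Local Open Scope classical_set_scope.
Local Open Scope ring_scope.

(** A superlevel set is a union of integer boxes in which [E] has density more
    than [alpha], and the Tauberian constant is the best bound on the size of a
    finite part of it.  In dimension one a minimal subfamily of intervals has
    multiplicity at most two, which gives [2 / alpha - 1]; a long interval [E]
    attains it in the limit.  Iterating the one-dimensional bound over the
    coordinates, at halved levels, shows that the constant is finite in every
    dimension.

    For the regularity, replace every lattice point by [N] points along one
    axis, keeping all [N] over [E] and adding [k] of them over each other point
    of the boxes.  With [d = k / N], the density of these boxes increases from
    [alpha] to [alpha + d (1 - alpha)], while the size of the set increases by a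
    factor of at most [1 + d (C(alpha) - 1)].  Hence
    [C(alpha) <= C(beta) (1 + d (C(alpha) - 1))] for
    [beta < alpha + d (1 - alpha)], so that [C] is locally Lipschitz and a
    fortiori locally Hoelder of order [1 / n]. *)

(** * Counting in finite sets *)

Section FsetCounting.
Variables (R : realFieldType) (T : choiceType).
Implicit Types A B S : {fset T}.

Lemma card_fset_sum_mem S A : (S `<=` A)%fset ->
  #|` S|%:R = \sum_(x <- A) (x \in S)%:R :> R.
Proof.
move=> sSA.
rewrite -(big_fset_incl _ sSA (F := fun x => (x \in S)%:R)) /=; last first.
  by move=> x _ /negPf ->.
rewrite card_fset_sum1 natr_sum big_seq [RHS]big_seq.
by apply: eq_bigr => x ->.
Qed.

Lemma card_bigfcup_disjoint (I : choiceType) (K : {fset I}) (G : I -> {fset T}) :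
  (forall i j, i \in K -> j \in K -> i != j -> [disjoint G i & G j]%fset) ->
  #|` \bigcup_(i <- K) G i|%fset = (\sum_(i <- K) #|` G i|)%N.
Proof.
move=> dG; rewrite card_fset_sum1 (partition_disjoint_bigfcup _ _ dG).
by apply: eq_bigr => i _; rewrite card_fset_sum1.
Qed.

End FsetCounting.

(** * Integer boxes and their slices *)

Section Boxes.
Variable n : nat.
Implicit Types (l u m x : 'rV[int]_n) (i j : 'I_n).

Definition box_set l u : set 'rV[int]_n :=
  [set x | forall i, l 0 i <= x 0 i <= u 0 i].

Lemma finite_box_set l u : finite_set (box_set l u).
Proof.
(* One bound [M] on all side lengths lets the offsets from [l] range over a finite function type. *)
pose M := (\sum_i `|(u 0 i - l 0 i)%R|)%N.
pose f (g : {ffun 'I_n -> 'I_M.+1}) : 'rV[int]_n :=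
  \row_i (l 0 i + (g i)%:Z : int).
apply: (@sub_finite_set _ _ (f @` setT)); last exact/finite_image/finite_finset.
move=> x /= bx; exists [ffun i => inord `|(x 0 i - l 0 i)%R|%N] => //.
apply/rowP => i; rewrite !mxE ffunE inordK.
  by have : l 0 i <= x 0 i <= u 0 i := bx i; lia.
have : (`|(u 0 i - l 0 i)%R| <= M)%N by rewrite /M (bigD1 i) //= leq_addr.
by have : l 0 i <= x 0 i <= u 0 i := bx i; lia.
Qed.

Definition box l u : {fset 'rV[int]_n} := fset_set (box_set l u).

Lemma in_box l u x : (x \in box l u) = [forall i, l 0 i <= x 0 i <= u 0 i].
Proof.
rewrite in_fset_set; last exact: finite_box_set.
by apply/idP/forallP; rewrite inE.
Qed.

Lemma boxP l u x :
  reflect (forall i, l 0 i <= x 0 i <= u 0 i) (x \in box l u).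
Proof. by rewrite in_box; exact: forallP. Qed.

Definition replace m i (t : int) : 'rV[int]_n :=
  \row_j (if j == i then t else m 0 j).

Lemma replace_id m i : replace m i (m 0 i) = m.
Proof. by apply/rowP => j; rewrite mxE; case: eqP => // ->. Qed.

Lemma replace_replace m i t t' : replace (replace m i t) i t' = replace m i t'.
Proof. by apply/rowP => j; rewrite !mxE; case: eqP. Qed.

(** Moving the [i]-th coordinate is injective on a slice. Hence all slices of a box orthogonal to
    direction [i] carry the same weight when densities are averaged. *)
Lemma card_box_slice l u i t t' :
  #|` box (replace l i t) (replace u i t)| =
  #|` box (replace l i t') (replace u i t')|.
Proof.
have le a b : (#|` box (replace l i a) (replace u i a)| <=
               #|` box (replace l i b) (replace u i b)|)%N.
  have <- : #|` [fset replace x i b | x in box (replace l i a) (replace u i a)]%fset|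
            = #|` box (replace l i a) (replace u i a)|.
    apply: card_in_imfset => x y /boxP/(_ i) + /boxP/(_ i).
    rewrite !mxE eqxx -!eq_le => /eqP xi /eqP yi /rowP e.
    apply/rowP => j; have := e j; rewrite !mxE.
    by case: (eqVneq j i) => // -> _; rewrite -xi -yi.
  apply/fsubset_leq_card/fsubsetP => _ /imfsetP[x /= /boxP xb ->].
  apply/boxP => j; rewrite !mxE; case: (eqVneq j i) => [_|ji]; first by lia.
  by have := xb j; rewrite !mxE (negPf ji).
by apply/eqP; rewrite eqn_leq !le.
Qed.

End Boxes.

(** * Tauberian bounds for finite sets, and the case of segments *)

Section Bounds.
Variables (R : realFieldType) (n : nat).
Implicit Types (F U : {fset 'rV[int]_n}) (l u m x : 'rV[int]_n) (i j : 'I_n)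
  (s : seq 'I_n) (a : R).

(* Only the sides in the directions listed in [s] may be nontrivial. *)
Definition superlevel s a F m : Prop :=
  exists l u, [/\ m \in box l u, forall j, j \notin s -> l 0 j = u 0 j
    & a * #|` box l u|%:R < #|` box l u `&` F|%fset%:R].

(** Bounding every finite part [U] of the superlevel set gives a meaning to the bound before that
    set is known to be finite. *)
Definition tauberian_bound s a (c : R) : Prop :=
  forall F U, (forall m, m \in U -> superlevel s a F m) ->
  #|` U|%:R <= c * #|` F|%:R.

(** Each point of [U] carries a box of its own, so a subfamily of boxes is a set [W] of points of
    [U]. *)
Definition covers (U : {fset 'rV[int]_n}) (lo hi : U -> 'rV[int]_n)
    (W : {set U}) :=
  [forall m : U, [exists w in W, val m \in box (lo w) (hi w)]].

(* Among three segments through [x], the one reaching furthest down and the one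
   reaching furthest up cover the third. *)
Lemma minimal_cover_multiplicity (U : {fset 'rV[int]_n}) (i : 'I_n)
    (lo hi : U -> 'rV[int]_n) (W : {set U}) x :
  (forall w j, j != i -> lo w 0 j = hi w 0 j) ->
  minset (covers lo hi) W ->
  (#|[set w in W | x \in box (lo w) (hi w)]| <= 2)%N.
Proof.
move=> seg /minsetP[covW minW]; set S := [set w in W | _].
rewrite leqNgt; apply/negP => S3.
have [w0 w0S] : exists w, w \in S by apply/card_gt0P/(ltn_trans _ S3).
have [w1 w1S lo1] := @arg_minP _ _ _ w0 (mem S) (fun w => lo w 0 i) w0S.
have [w2 w2S hi2] := @arg_maxP _ _ _ w0 (mem S) (fun w => hi w 0 i) w0S.
(* The extremal indices [w1] and [w2] may coincide; in any case a third index [w3] remains, and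
   dropping it will contradict minimality. *)
have : (0 < #|S :\: [set w1; w2]|)%N.
  rewrite cardsD subn_gt0 (leq_ltn_trans (subset_leq_card (subsetIr _ _))) //.
  by rewrite (leq_ltn_trans _ S3) // cards2; case: (w1 != w2).
case/card_gt0P => w3; rewrite !inE negb_or -andbA => /and3P[w31 w32].
rewrite -/S => /andP[w3W xw3].
have cov3 : covers lo hi (W :\ w3).
  apply/forallP => m; have /existsP[w /andP[wW mw]] := forallP covW m.
  have [ew|nw] := eqVneq w w3; last first.
    by apply/existsP; exists w; rewrite !inE nw wW.
  have S_box v : v \in S -> [/\ v \in W & x \in box (lo v) (hi v)].
    by rewrite inE => /andP.
  have [w1W /boxP xw1] := S_box _ w1S; have [w2W /boxP xw2] := S_box _ w2S.
  move: mw xw3; rewrite {}ew; move: (val m : 'rV[int]_n) => y /boxP mw3 /boxP xw3.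
  have mx j : j != i -> y 0 j = x 0 j.
    move=> ji; have := mw3 j; have := xw3 j.
    by rewrite (seg w3 j ji) -!eq_le => /eqP <- /eqP ->.
  (* A point of the box of [w3] differs from [x] only in coordinate [i]: it lies in the box of [w1]
     if it is not above [x], and in that of [w2] otherwise. *)
  apply/existsP; have [mi|mi] := leP (y 0 i) (x 0 i).
    exists w1; rewrite !inE eq_sym w31 w1W; apply/boxP => j.
    have [->|ji] := eqVneq j i; last by rewrite mx.
    have w3S : w3 \in S by rewrite inE w3W; apply/boxP.
    have [/andP[l3y _] /andP[_ xu1]] := (mw3 i, xw1 i).
    by rewrite (le_trans (lo1 _ w3S) l3y) (le_trans mi xu1).
  exists w2; rewrite !inE eq_sym w32 w2W; apply/boxP => j.
  have [->|ji] := eqVneq j i; last by rewrite mx.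
  have w3S : w3 \in S by rewrite inE w3W; apply/boxP.
  have [/andP[_ yu3] /andP[l2x _]] := (mw3 i, xw2 i).
  by rewrite (le_trans l2x (ltW mi)) (le_trans yu3 (hi2 _ w3S)).
have := minW _ cov3 (subsetDl _ _) => /setP/(_ w3).
by rewrite !inE eqxx w3W.
Qed.

(** Let [A] be the union of a minimal cover and [mu] its multiplicity. Summing the density
    inequalities gives a bound for [mu] on [A], and [1 <= mu <= 2] turns it into
    [a * #A <= (2 - a) * #(A & F)]. *)
Lemma tauberian_bound_line i a : 0 < a -> a <= 1 ->
  tauberian_bound [:: i] a (2 / a - 1).
Proof.
move=> a0 a1 F U sU.
have ex (m : U) : exists lu : 'rV[int]_n * 'rV[int]_n,
    [/\ val m \in box lu.1 lu.2, forall j, j != i -> lu.1 0 j = lu.2 0 j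
    & a * #|` box lu.1 lu.2|%:R < #|` box lu.1 lu.2 `&` F|%fset%:R].
  have [l [u [mb lu d]]] := sU _ (valP m); exists (l, u); split => // j ji.
  by apply: lu; rewrite inE.
pose lo (m : U) := (sval (cid (ex m))).1.
pose hi (m : U) := (sval (cid (ex m))).2.
have lohi w : [/\ val w \in box (lo w) (hi w),
    forall j, j != i -> lo w 0 j = hi w 0 j
    & a * #|` box (lo w) (hi w)|%:R < #|` box (lo w) (hi w) `&` F|%fset%:R].
  by rewrite /lo /hi; case: (cid (ex w)).
have covT : covers lo hi finset.setT.
  by apply/forallP => m; apply/existsP; exists m; rewrite inE; case: (lohi m).
have [W minW _] := minset_exists covT.
have mul2 x := minimal_cover_multiplicity x
  (fun w => let: And3 _ h _ := lohi w in h) minW.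
have [covW _] := minsetP minW.
pose A := (\bigcup_(w <- enum_fset [fset w in W]) box (lo w) (hi w))%fset.
have AP x : reflect (exists2 w, w \in W & x \in box (lo w) (hi w)) (x \in A).
  apply: (iffP (bigfcupP _ _ _ _)) => [[w]|[w wW xw]].
    by rewrite andbT in_fset => wW xw; exists w.
  by exists w => //; rewrite andbT in_fset.
have UA : (U `<=` A)%fset.
  apply/fsubsetP => x xU; have /existsP[w /andP[wW xw]] := forallP covW [` xU]%fset.
  by apply/AP; exists w.
pose mu x : R := #|[set w in W | x \in box (lo w) (hi w)]|%:R.
have muE x : mu x = \sum_(w in W) (x \in box (lo w) (hi w))%:R.
  rewrite /mu -sum1_card natr_sum big_mkcond [RHS]big_mkcond.
  by apply: eq_bigr => w _; rewrite inE; case: (w \in W); case: (x \in _).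
(* Double counting of pairs of a segment and a point of it; it is applied with [G = A] and with
   [G = F]. *)
have tot (G : {fset 'rV[int]_n}) :
    \sum_(w in W) #|` box (lo w) (hi w) `&` G|%fset%:R =
    \sum_(x <- A) mu x * (x \in G)%:R.
  under [RHS]eq_bigr do rewrite muE mulr_suml.
  rewrite exchange_big /=; apply: eq_bigr => w wW.
  rewrite (@card_fset_sum_mem _ _ _ A).
    by apply: eq_bigr => x _; rewrite inE -natrM mulnb.
  by apply/fsubsetP => x /fsetIP[xw _]; apply/AP; exists w.
have le1 : a * \sum_(x <- A) mu x <= \sum_(x <- A) mu x * (x \in F)%:R.
  have -> : \sum_(x <- A) mu x = \sum_(x <- A) mu x * (x \in A)%:R.
    by rewrite big_seq [RHS]big_seq; apply: eq_bigr => x ->; rewrite mulr1.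
  rewrite -!tot mulr_sumr; apply: ler_sum => w wW.
  have -> : (box (lo w) (hi w) `&` A = box (lo w) (hi w))%fset.
    by apply/fsetIidPl/fsubsetP => x xw; apply/AP; exists w.
  by have [_ _ /ltW] := lohi w.
have FA : #|` A `&` F|%fset%:R <= #|` F|%:R :> R.
  by rewrite ler_nat fsubset_leq_card // fsubsetIr.
apply: (@le_trans _ _ #|` A|%:R); first by rewrite ler_nat fsubset_leq_card.
apply: (@le_trans _ _ ((2 / a - 1) * #|` A `&` F|%fset%:R)); last first.
  by apply: ler_wpM2l => //; rewrite subr_ge0 ler_pdivlMr //; lra.
rewrite (@card_fset_sum_mem _ _ (A `&` F)%fset A) ?fsubsetIl //.
have -> : #|` A|%:R = \sum_(x <- A) 1 :> R by rewrite card_fset_sum1 natr_sum.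
(* Pointwise bound, using [1 <= mu <= 2] and [a <= 1]. *)
have : \sum_(x <- A) (a * 1 + (mu x * (x \in F)%:R - a * mu x)) <=
       \sum_(x <- A) (2 - a) * (x \in (A `&` F)%fset)%:R.
  rewrite big_seq [leRHS]big_seq; apply: ler_sum => x xA.
  have mu1 : 1 <= mu x.
    rewrite ler1n; have [w wW xw] := AP _ xA.
    by apply/card_gt0P; exists w; rewrite inE wW.
  have mu2 : mu x <= 2 by rewrite ler_nat; exact: mul2.
  by rewrite inE xA /=; case: (x \in F) => /=; nra.
rewrite big_split sumrB -!mulr_sumr /= => le2.
have : a * \sum_(x <- A) 1 <= (2 - a) * \sum_(x <- A) (x \in (A `&` F)%fset)%:R.
  by lra.
set p := \sum_(x <- A) 1; set q := \sum_(x <- A) _ => pq.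
rewrite -(ler_pM2l a0) mulrA mulrBr mulr1 mulrCA divff ?gt_eqF //.
by rewrite mulr1.
Qed.

End Bounds.

(** * Decomposition of a box into slices along a line *)

Section Slicing.
Variable n : nat.
Implicit Types (l u m x : 'rV[int]_n) (i j : 'I_n) (G : {fset 'rV[int]_n}).

Definition slice l u i (t : int) := box (replace l i t) (replace u i t).

(** When [m] is in the box, this is the part in the box of the line through [m] in direction [i];
    its points index the slices orthogonal to [i]. *)
Definition fiber l u m i := box (replace m i (l 0 i)) (replace m i (u 0 i)).

Lemma mem_fiber l u m i x :
  x \in fiber l u m i ->
  [/\ l 0 i <= x 0 i <= u 0 i & x = replace m i (x 0 i)].
Proof.
move=> /boxP xb; split; first by have := xb i; rewrite !mxE eqxx.
apply/rowP => j; rewrite mxE; case: eqP => [->//|/eqP ji].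
by have := xb j; rewrite !mxE (negPf ji) -eq_le => /eqP.
Qed.

Lemma fiber_sub_box l u m i : m \in box l u -> (fiber l u m i `<=` box l u)%fset.
Proof.
move=> /boxP mb; apply/fsubsetP => x /mem_fiber[xi ->].
by apply/boxP => j; rewrite mxE; case: eqP => [->|].
Qed.

Lemma mem_slice l u i x : x \in box l u -> x \in slice l u i (x 0 i).
Proof.
by move=> /boxP xb; apply/boxP => j; rewrite !mxE; case: eqP => // ->; rewrite lexx.
Qed.

Lemma slice_coord l u i t x : x \in slice l u i t -> x 0 i = t.
Proof.
by move=> /boxP/(_ i); rewrite !mxE eqxx -eq_le => /eqP.
Qed.

Lemma slice_sub_box l u i t : l 0 i <= t <= u 0 i ->
  (slice l u i t `<=` box l u)%fset.
Proof.
move=> ti; apply/fsubsetP => x xs; have xt := slice_coord xs.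
apply/boxP => j; have [->|ji] := eqVneq j i; first by rewrite xt.
by have /boxP/(_ j) := xs; rewrite !mxE (negPf ji).
Qed.

(** A discrete Fubini formula: the slices through the points of the fiber partition the box. *)
Lemma card_box_fiber l u m i G : m \in box l u ->
  #|` box l u `&` G|%fset =
  (\sum_(x <- fiber l u m i) #|` slice l u i (x 0%R i) `&` G|%fset)%N.
Proof.
move=> mb; rewrite -card_bigfcup_disjoint; last first.
  move=> x y /mem_fiber[_ ex] /mem_fiber[_ ey] xy.
  apply/fdisjointP => z /fsetIP[/slice_coord zx _].
  apply/negP => /fsetIP[/slice_coord zy _].
  by move: xy; rewrite ex ey -zx zy eqxx.
congr #|` _|; apply/fsetP => z; apply/fsetIP/bigfcupP => [[zb zG]|].
  exists (replace m i (z 0 i)); last first.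
    by rewrite inE zG andbT mxE eqxx mem_slice.
  rewrite andbT; apply/boxP => j; rewrite !mxE.
  by case: eqP => _; [exact: (boxP _ _ _ zb) | rewrite lexx].
move=> [x /andP[/mem_fiber[xi _] _] /fsetIP[zs zG]]; split => //.
exact: (fsubsetP (slice_sub_box xi)).
Qed.

End Slicing.

(** * Finiteness of the bound by iteration over the coordinates *)

Section Iteration.
Variables (R : realFieldType) (n : nat).
Implicit Types (s : seq 'I_n) (i : 'I_n) (a c : R).

(* A box of density more than [a] meets, in a proportion of more than [a / 2]
   of its fiber in direction [i], slices of density more than [a / 2]. *)
Lemma tauberian_bound_cons i s a c1 c2 : 0 < a -> 0 <= c2 ->
  tauberian_bound s (a / 2) c1 -> tauberian_bound [:: i] (a / 2) c2 ->
  tauberian_bound (i :: s) a (c2 * c1).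
Proof.
move=> a0 c20 b1 b2 F U sU.
have /choice[lu luP] (m : 'rV[int]_n) : exists lu : 'rV[int]_n * 'rV[int]_n,
    m \in U -> [/\ m \in box lu.1 lu.2,
    forall j, j \notin i :: s -> lu.1 0 j = lu.2 0 j
    & a * #|` box lu.1 lu.2|%:R < #|` box lu.1 lu.2 `&` F|%fset%:R].
  have [mU|/negP nU] := boolP (m \in U); last by exists (0, 0).
  by have [l [u h]] := sU _ mU; exists (l, u).
(* Intersecting with the union of the chosen boxes keeps [G] finite. *)
pose G := [fset x in (\bigcup_(m <- enum_fset U) box (lu m).1 (lu m).2)%fset |
           `[< superlevel s (a / 2) F x >]]%fset.
have G1 : #|` G|%:R <= c1 * #|` F|%:R.
  by apply: b1 => x; rewrite !inE /= => /andP[_ /asboolP].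
apply: (@le_trans _ _ (c2 * #|` G|%:R)); last first.
  by rewrite -mulrA ler_wpM2l.
apply: b2 => m mU; have [] := luP _ mU.
set l := (lu m).1; set u := (lu m).2 => mb lus d.
exists (replace m i (l 0 i)), (replace m i (u 0 i)); split.
- apply/boxP => j; rewrite !mxE.
  by case: eqP => [->|_]; [exact: (boxP _ _ _ mb) | rewrite lexx].
- by move=> j; rewrite inE !mxE => /negPf ->.
rewrite -/(fiber l u m i).
pose K : R := #|` slice l u i (m 0 i)|%:R.
have KE t : #|` slice l u i t|%:R = K.
  by rewrite /K /slice (card_box_slice _ _ _ _ t).
have K0 : 0 < K.
  by rewrite ltr0n cardfs_gt0; apply/fset0Pn; exists m; exact: mem_slice.
have bE : #|` box l u|%:R = K * #|` fiber l u m i|%:R.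
  rewrite -[box l u]fsetIid (card_box_fiber i _ mb) natr_sum card_fset_sum1.
  rewrite natr_sum mulr_sumr big_seq [RHS]big_seq.
  apply: eq_bigr => x /mem_fiber[xi _].
  by rewrite mulr1 (fsetIidPl (slice_sub_box xi)) KE.
move: d; rewrite bE (card_box_fiber i _ mb) natr_sum => lt1.
(* A slice through a point of [G] counts at most [K]. Any other slice counts at most [a / 2 * K],
   since otherwise it would witness that its point is in [G]. *)
have : \sum_(x <- fiber l u m i) #|` slice l u i (x 0 i) `&` F|%fset%:R <=
       \sum_(x <- fiber l u m i)
         (K * (x \in (fiber l u m i `&` G)%fset)%:R + a / 2 * K).
  rewrite big_seq [leRHS]big_seq; apply: ler_sum => x xf.
  have xb := fsubsetP (fiber_sub_box i mb) _ xf.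
  rewrite inE xf /=; have [xG|xG] := boolP (x \in G).
    rewrite mulr1 -(KE (x 0 i)) ler_wpDr ?mulr_ge0 ?ler0n ?divr_ge0 ?(ltW a0) //.
    by rewrite ler_nat fsubset_leq_card // fsubsetIl.
  rewrite mulr0 add0r leNgt; apply/negP => lt2; move/negP: xG; apply.
  rewrite !inE /=; apply/andP; split.
    by apply/bigfcupP; exists m; rewrite ?mU.
  apply/asboolP; exists (replace l i (x 0 i)), (replace u i (x 0 i)); split.
  - exact: mem_slice.
  - move=> j js; rewrite !mxE; case: (eqVneq j i) => // ji.
    by apply: lus; rewrite inE negb_or ji.
  - by rewrite -/(slice l u i (x 0 i)) KE.
rewrite big_split /= -mulr_sumr -card_fset_sum_mem ?fsubsetIl //.
have -> : \sum_(x <- fiber l u m i) a / 2 * K = a / 2 * K * #|` fiber l u m i|%:R.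
  rewrite card_fset_sum1 natr_sum mulr_sumr.
  by apply: eq_bigr => x _; rewrite mulr1.
move=> le2; have := lt_le_trans lt1 le2; rewrite -(ltr_pM2l K0).
by set p := _%:R; set q := _%:R; nra.
Qed.

(** Induction on the directions: with none left a box is a single point and 1 is a bound; each
    further direction costs a halving of the level. *)
Lemma tauberian_bound_exists s a : 0 < a -> a <= 1 ->
  exists2 c, 0 <= c & tauberian_bound s a c.
Proof.
elim: s a => [|i s IHs] a a0 a1.
  exists 1; rewrite ?ler01 // => F U sU; rewrite mul1r ler_nat.
  apply/fsubset_leq_card/fsubsetP => m /sU[l [u [mb lu d]]].
  have e x : x \in box l u -> x = l.
    move=> /boxP xb; apply/rowP => j.
    by have := xb j; rewrite lu // -eq_le => /eqP.
  have : (0 < #|` box l u `&` F|%fset)%N.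
    rewrite -(ltr0n R); apply: le_lt_trans d.
    by rewrite mulr_ge0 ?ler0n ?ltW.
  rewrite cardfs_gt0 => /fset0Pn[x /fsetIP[/e -> lF]].
  by rewrite (e m).
have [||c c0 bc] := IHs (a / 2); [lra|lra|].
have c20 : 0 <= 2 / (a / 2) - 1 by rewrite subr_ge0 ler_pdivlMr; lra.
exists ((2 / (a / 2) - 1) * c); first by rewrite mulr_ge0.
apply: tauberian_bound_cons => //.
by apply: tauberian_bound_line; lra.
Qed.

End Iteration.

(** * Replacing lattice points by blocks along one axis *)

Section Thickening.
Variables (n : nat) (i : 'I_n) (N : nat).
Hypothesis N0 : (0 < N)%N.
Implicit Types (x z l u : 'rV[int]_n) (S : {fset 'rV[int]_n}) (k : nat).

(** Point [x] owns the block of [N] consecutive points starting at [N * x] in direction [i]; the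
    first [k] of them are kept. *)
Definition thicken k S : {fset 'rV[int]_n} :=
  (\bigcup_(x <- enum_fset S)
    [fset replace x i (N%:Z * x 0 i + Posz (nat_of_ord t)) | t in 'I_k])%fset.

(** Sends a point to the owner of its block, and so inverts the thickening. *)
Definition shrink z := replace z i (z 0%R i %/ N)%Z.

Lemma divz_block (q : int) (t : nat) : (t < N)%N -> ((N%:Z * q + t%:Z) %/ N)%Z = q.
Proof.
by move=> tN; rewrite mulrC divzMDl ?divz_small ?addr0 //; lia.
Qed.

Lemma shrink_replace x (t : nat) : (t < N)%N ->
  shrink (replace x i (N%:Z * x 0 i + t%:Z)) = x.
Proof.
by move=> tN; rewrite /shrink mxE eqxx replace_replace divz_block ?replace_id.
Qed.

Lemma in_thicken k S z : (k <= N)%N ->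
  (z \in thicken k S) = (shrink z \in S) && ((z 0%R i %% N)%Z < k%:Z).
Proof.
move=> kN; apply/bigfcupP/andP => [[x]|[zS zk]].
  rewrite andbT => xS /imfsetP[t /= _ ->].
  have tk := ltn_ord t; have tN : (t < N)%N := leq_trans tk kN.
  by rewrite shrink_replace // mxE eqxx mulrC modzMDl modz_small //; lia.
exists (shrink z); first by rewrite zS.
have NZ : N%:Z != 0 by lia.
have zk' : (`|(z 0%R i %% N)%Z| < k)%N.
  by have := modz_ge0 (z 0 i) NZ; move: zk; set p := (_ %% _)%Z; lia.
apply/imfsetP; exists (Ordinal zk') => //=.
rewrite /shrink replace_replace mxE eqxx gez0_abs ?modz_ge0 //.
by rewrite mulrC -divz_eq replace_id.
Qed.

Lemma card_thicken k S : (k <= N)%N -> #|` thicken k S| = (k * #|` S|)%N.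
Proof.
move=> kN; rewrite card_bigfcup_disjoint.
  rewrite (eq_bigr (fun=> k)); last first.
    move=> x _; rewrite card_imfset /=; last first.
      move=> t t' /rowP/(_ i); rewrite !mxE eqxx => /addrI[] tt'.
      exact: val_inj.
    by rewrite -cardE card_ord.
  by rewrite big_const_seq count_predT iter_addn_0 mulnC.
have sh x z : z \in [fset replace x i (N%:Z * x 0 i + Posz (nat_of_ord t))
    | t in 'I_k]%fset -> shrink z = x.
  by move=> /imfsetP[t /= _ ->]; rewrite shrink_replace ?(leq_trans (ltn_ord t)).
move=> x y xS yS xy; apply/fdisjointP => z /sh zx; apply/negP => /sh zy.
by move: xy; rewrite -zx -zy eqxx.
Qed.

(** Full blocks are contiguous, so a thickened box is again an admissible box; [N - 1] in the upper
    corner reaches the end of the last block. *)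
Lemma thicken_box l u :
  thicken N (box l u) =
  box (replace l i (N%:Z * l 0 i)) (replace u i (N%:Z * u 0 i + N%:Z - 1)).
Proof.
have NZ : N%:Z != 0 by lia.
apply/fsetP => z; rewrite in_thicken //.
have zi : (l 0 i <= (z 0%R i %/ N)%Z <= u 0 i) =
    (N%:Z * l 0 i <= z 0 i <= N%:Z * u 0 i + N%:Z - 1).
  have := divz_eq (z 0 i) N; have := modz_ge0 (z 0 i) NZ.
  have := ltz_pmod (z 0 i) (_ : 0 < N%:Z); rewrite ltz_nat => /(_ N0).
  set q := (_ %/ _)%Z; set r := (_ %% _)%Z => rN r0 ->.
  by apply/idP/idP; nia.
have -> : ((z 0%R i %% N)%Z < N%:Z) by rewrite ltz_pmod.
rewrite andbT !in_box; apply: eq_forallb => j; rewrite !mxE.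
by case: eqP => // ->.
Qed.

End Thickening.

(** * Comparison of two levels by dilation *)

Section Dilation.
Variables (R : realFieldType) (n : nat).
Implicit Types (i : 'I_n) (a b : R) (F U : {fset 'rV[int]_n}).

Definition strong_superlevel a F := superlevel (enum 'I_n) a F.
Definition strong_bound a (c : R) := tauberian_bound (enum 'I_n) a c.

Lemma strong_superlevelP a F m :
  strong_superlevel a F m <->
  exists l u, m \in box l u /\ a * #|` box l u|%:R < #|` box l u `&` F|%fset%:R.
Proof.
split=> [[l [u [mb _ d]]]|[l [u [mb d]]]]; exists l, u; split => //.
by move=> j; rewrite mem_enum.
Qed.

(** The one-point box at [m] has density 1. *)
Lemma strong_superlevel_self a F m : a < 1 -> m \in F -> strong_superlevel a F m.
Proof.
move=> a1 mF; apply/strong_superlevelP; exists m, m.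
have mb : m \in box m m by apply/boxP => j; rewrite lexx.
split=> //.
have bm : (box m m `<=` F)%fset.
  apply/fsubsetP => x /boxP xb; suff -> : x = m by [].
  by apply/rowP => j; have := xb j; rewrite -eq_le => /eqP.
rewrite (fsetIidPl bm) -[ltRHS]mul1r ltr_pM2r // ltr0n cardfs_gt0.
by apply/fset0Pn; exists m.
Qed.

(* The witnessing boxes are stretched [N] times in direction [i]; each point of
   them outside [F] contributes [k] of the [N] points that replace it. *)
Lemma strong_bound_dilate i (N k : nat) a b A B :
  (0 < N)%N -> (k <= N)%N -> 0 <= B -> a < 1 ->
  b * N%:R < a * N%:R + k%:R * (1 - a) ->
  strong_bound a A -> strong_bound b B ->
  strong_bound a (B * (1 + k%:R / N%:R * (A - 1))).
Proof.
move=> N0 kN B0 a1 ab bA bB F U sU.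
have /choice[lu luP] (m : 'rV[int]_n) : exists lu : 'rV[int]_n * 'rV[int]_n,
    m \in U -> m \in box lu.1 lu.2 /\
    a * #|` box lu.1 lu.2|%:R < #|` box lu.1 lu.2 `&` F|%fset%:R.
  have [mU|/negP nU] := boolP (m \in U); last by exists (0, 0).
  by have /strong_superlevelP[l [u h]] := sU _ mU; exists (l, u).
(* All of [V] lies in the superlevel set of [F] at level [a], because a box that witnesses one point
   witnesses all of its points. *)
pose V := (F `|` \bigcup_(m <- enum_fset U) box (lu m).1 (lu m).2)%fset.
have VA : #|` V|%:R <= A * #|` F|%:R.
  apply: bA => x; rewrite inE => /orP[xF|]; first exact: strong_superlevel_self.
  move=> /bigfcupP[m]; rewrite andbT => /luP[mb d] xb.
  by apply/strong_superlevelP; exists (lu m).1, (lu m).2.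
pose F' := (thicken i N N F `|` thicken i N k (V `\` F))%fset.
have mF' z : (z \in F') = (shrink i N z \in F) ||
    (shrink i N z \in (V `\` F)%fset) && ((z 0%R i %% N)%Z < k%:Z).
  have NZ : (0 < N%:Z) by lia.
  by rewrite inE !in_thicken // ltz_pmod // andbT.
have cardI G : (G `<=` V)%fset -> #|` thicken i N N G `&` F'|%fset =
    (N * #|` G `&` F|%fset + k * #|` G `\` F|%fset)%N.
  move=> GV; rewrite -!(card_thicken i N0) //.
  have -> : (thicken i N N G `&` F' =
      thicken i N N (G `&` F) `|` thicken i N k (G `\` F))%fset.
    apply/fsetP => z; rewrite in_fsetI mF' in_fsetU !in_thicken //.
    have NZ : (0 < N%:Z) by lia.
    rewrite ltz_pmod // !andbT !inE.
    have [zG|] := boolP (shrink i N z \in G); last by rewrite andbF.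
    have := fsubsetP GV _ zG; rewrite inE => -> /=.
    by rewrite andbT.
  rewrite cardfsU; set D := (X in (_ - #|` X|)%N); suff -> : D = fset0.
    by rewrite cardfs0 subn0.
  apply/eqP; rewrite -fsubset0; apply/fsubsetP => z; rewrite in_fsetI.
  rewrite !in_thicken // !inE => /andP[/andP[/andP[_ zF] _]].
  by rewrite zF.
have cardF' : #|` F'| = (N * #|` F| + k * #|` V `\` F|%fset)%N.
  have FV : (F `<=` V)%fset by exact: fsubsetUl.
  rewrite -[X in (N * #|` X|)%N](fsetIidPr FV) -cardI //; congr #|` _|.
  apply/esym/fsetIidPr.
  apply/fsubsetP => z; rewrite mF' in_thicken // ltz_pmod ?andbT; last by lia.
  by move=> /orP[/(fsubsetP FV)//|/andP[/fsetDP[]]].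
have N0R : 0 < N%:R :> R by rewrite ltr0n.
have : #|` thicken i N N U|%:R <= B * #|` F'|%:R.
  apply: bB => z; rewrite in_thicken // => /andP[mU]; have [] := luP _ mU.
  move: mU; set m := shrink i N z.
  set l := (lu m).1; set u := (lu m).2 => mU mb d zN.
  apply/strong_superlevelP.
  exists (replace l i (N%:Z * l 0 i)), (replace u i (N%:Z * u 0 i + N%:Z - 1)).
  rewrite -thicken_box // in_thicken // mb; split => //.
  rewrite cardI; last first.
    apply/fsubsetP => x xb; rewrite inE; apply/orP; right.
    by apply/bigfcupP; exists m; rewrite ?mU.
  rewrite card_thicken // -(cardfsID F (box l u)) natrD !natrM natrD.
  move: d; rewrite -(cardfsID F (box l u)) natrD.
  set p := #|` box l u `&` F|%fset%:R; set q := #|` box l u `\` F|%fset%:R.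
  move=> d.
  have kNR : k%:R <= N%:R :> R by rewrite ler_nat.
  have pq : 0 < p + q.
    rewrite -natrD cardfsID ltr0n cardfs_gt0; apply/fset0Pn.
    by exists m.
  (* From [a * (p + q) < p]: [N * p + k * q = (N - k) * p + k * (p + q)], which is at least
     [(a * N + k * (1 - a)) * (p + q)], as [k <= N]. *)
  have := ltr_pM2r pq (b * N%:R) (a * N%:R + k%:R * (1 - a)); rewrite ab.
  by nra.
rewrite card_thicken // cardF' natrD !natrM => lt1.
have VD : #|` V `\` F|%fset%:R = #|` V|%:R - #|` F|%:R :> R.
  by rewrite -(cardfsID F V) natrD fsetIC (fsetIidPl (fsubsetUl _ _)) addrC addKr.
have k0 : 0 <= k%:R :> R by rewrite ler0n.
rewrite -(ler_pM2l N0R); apply: le_trans lt1 _; rewrite VD.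
have -> : N%:R * (B * (1 + k%:R / N%:R * (A - 1)) * #|` F|%:R) =
   B * (N%:R * #|` F|%:R + k%:R * (A * #|` F|%:R - #|` F|%:R)).
  by field; rewrite gt_eqF.
by rewrite ler_wpM2l // lerD2l ler_wpM2l // lerB.
Qed.

End Dilation.

(** * From the maximal operator to densities in integer boxes *)

Section Transfer.
Variables (R : realType) (n : nat).
Implicit Types (a c : R) (m l u : 'rV[int]_n) (E : set 'rV[int]_n)
  (Q : set 'rV[R]_n).

Lemma translate_box m l u :
  [fset (m + x)%R | x in box l u]%fset = box (m + l) (m + u).
Proof.
apply/fsetP => y; apply/imfsetP/boxP => [[x /= /boxP xb -> i]|yb].
  by rewrite !mxE !lerD2l; exact: xb.
exists (y - m); last by rewrite addrC subrK.
by apply/boxP => i; have := yb i; rewrite !mxE lerBrDl lerBlDl.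
Qed.

Lemma card_translate_box m l u : #|` box (m + l) (m + u)| = #|` box l u|.
Proof.
by rewrite -translate_box card_imfset //; exact: addrI.
Qed.

Lemma rectangle_average_box E m Q l u : finite_set E ->
  lattice_points Q = box_set l u ->
  rectangle_average (\1_E : _ -> R) m Q =
  (#|` box (m + l) (m + u)|%:R)^-1 *
    #|` box (m + l) (m + u) `&` fset_set E|%fset%:R.
Proof.
move=> fE QE; rewrite /rectangle_average QE card_translate_box; congr (_ * _).
rewrite (fsbig_finite _ _ (finite_box_set l u)) -/(box l u).
rewrite (card_fset_sum_mem _ (fsubsetIl _ _)) -translate_box.
rewrite big_imfset /=; last first.
  by move=> x y _ _ /addrI.
rewrite big_seq [RHS]big_seq; apply: eq_bigr => x xb.
rewrite indicE normr_nat inE in_fset_set //.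
by rewrite translate_box -translate_box in_imfset.
Qed.

(** The sides are open: the least integer above [t] is [floor t + 1], the greatest below [t] is
    [ceil t - 1]. *)
Lemma lattice_points_rectangle (b b' : 'rV[R]_n) :
  lattice_points [set x : 'rV[R]_n | forall i, b 0 i < x 0 i < b' 0 i] =
  box_set (\row_i (Num.floor (b 0 i) + 1)) (\row_i (Num.ceil (b' 0 i) - 1)).
Proof.
apply/seteqP; split=> x /= xb i; have := xb i;
  by rewrite !mxE lerBrDr !lezD1 floor_lt_int ceil_gt_int.
Qed.

(** Conversely, pushing each face out by one gives an open rectangle with exactly these lattice
    points. *)
Lemma lattice_points_box l u :
  lattice_points [set x : 'rV[R]_n | forall i,
    (\row_i (l 0 i - 1)%:~R : 'rV[R]_n) 0 i < x 0 i
      < (\row_i (u 0 i + 1)%:~R : 'rV[R]_n) 0 i] = box_set l u.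
Proof.
apply/seteqP; split=> x /= xb i; have := xb i;
  by rewrite !mxE !ltr_int ltrBlDr !ltzD1.
Qed.

(** A supremum exceeds [a] exactly when one of the averages does, and translation by [m] carries
    rectangles around the origin to boxes containing [m]. *)
Lemma strong_maximal_gt E m a : finite_set E ->
  (a%:E < strong_maximal (\1_E : _ -> R) m)%E <->
  strong_superlevel a (fset_set E) m.
Proof.
move=> fE.
have avg Q l u : lattice_points Q = box_set l u -> Q 0 ->
    m \in box (m + l) (m + u) /\
    (a < rectangle_average (\1_E : _ -> R) m Q) =
    (a * #|` box (m + l) (m + u)|%:R <
      #|` box (m + l) (m + u) `&` fset_set E|%fset%:R).
  move=> QE Q0; have mb : m \in box (m + l) (m + u).
    rewrite -translate_box; apply/imfsetP; exists 0; last by rewrite addr0.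
    have : lattice_points Q 0 by rewrite /lattice_points /= map_mx0.
    by rewrite QE => b0; apply/boxP.
  split => //; rewrite (rectangle_average_box m fE QE) mulrC ltr_pdivlMr //.
  by rewrite ltr0n cardfs_gt0; apply/fset0Pn; exists m.
split.
  move=> /ereal_sup_gt[_ [Q [[b [b' Qb]] Q0] <-]]; rewrite lte_fin.
  have QE := lattice_points_rectangle b b'; rewrite -Qb in QE.
  have [mb ->] := avg _ _ _ QE Q0 => d.
  apply/strong_superlevelP; exists (m + \row_i (Num.floor (b 0 i) + 1)).
  by exists (m + \row_i (Num.ceil (b' 0 i) - 1)).
move=> /strong_superlevelP[l [u [mb d]]].
have QE := lattice_points_box (l - m) (u - m).
set Q := [set x : 'rV[R]_n | _] in QE.
have Q0 : Q 0.
  move=> i; rewrite !mxE ltrz0 ltr0z ltrBlDr !ltzD1 subr_le0 subr_ge0.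
  exact: boxP mb i.
have [_ e] := avg _ _ _ QE Q0; move: e; rewrite !subrKC d => lta.
apply: lt_le_trans (ereal_sup_ubound _); last first.
  exists Q => //; split => //.
  by exists (\row_i ((l - m) 0 i - 1)%:~R), (\row_i ((u - m) 0 i + 1)%:~R).
by rewrite lte_fin lta.
Qed.

(** Links the supremum in the extended reals to bounds on finite sets. Finiteness of the superlevel
    set has to be derived in both directions. *)
Lemma tauberian_const_le a c : 0 < a ->
  (tauberian_const n a <= c%:E)%E <-> (0 <= c /\ strong_bound n a c).
Proof.
move=> a0; split=> [Tc|[c0 bc]].
  have ratio E : finite_set E -> (0 < #|` fset_set E|)%N ->
      ((#|` fset_set E|%:R^-1)%:E *
       counting [set m | a%:E < strong_maximal (\1_E : _ -> R) m] <= c%:E)%E.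
    move=> fE E0; apply: le_trans Tc; apply: ereal_sup_ubound.
    have cE : counting E = (#|` fset_set E|%:R)%:E :> \bar R.
      by rewrite /counting asboolT.
    by exists E; rewrite /= cE //= lte_fin ltr0n E0 ltry.
  (* An infinite superlevel set would make the ratio [+oo]. *)
  have finS E : finite_set E -> (0 < #|` fset_set E|)%N ->
      finite_set [set m | (a%:E < strong_maximal (\1_E : _ -> R) m)%E].
    move=> fE E0; apply: contrapT => infS; have := ratio E fE E0.
    rewrite /counting asboolF // gt0_muley ?leye_eq //.
    by rewrite lte_fin invr_gt0 ltr0n.
  have bnd E : finite_set E -> (0 < #|` fset_set E|)%N ->
      #|` fset_set [set m | (a%:E < strong_maximal (\1_E : _ -> R) m)%E]|%:R
        <= c * #|` fset_set E|%:R.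
    move=> fE E0; have := ratio E fE E0.
    rewrite /counting asboolT; last exact: finS.
    by rewrite -EFinM lee_fin mulrC ler_pdivrMr // ltr0n.
  split.
    have := bnd [set` [fset (0 : 'rV[int]_n)]%fset] (finite_fset _).
    rewrite set_fsetK cardfs1 mulr1 => /(_ isT); exact: le_trans (ler0n _ _).
  (* The supremum runs over nonempty [E], so an empty [F] is treated apart. *)
  move=> F U sU; have [F0|F0] := posnP #|` F|.
    rewrite F0 mulr0; suff -> : U = fset0 by rewrite cardfs0.
    apply/eqP; rewrite -fsubset0; apply/fsubsetP => m /sU[l [u [_ _]]].
    rewrite (cardfs0_eq F0) fsetI0 cardfs0 ltNge mulr_ge0 ?ler0n //.
    exact: ltW.
  have := bnd [set` F] (finite_fset _); rewrite set_fsetK => /(_ F0).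
  apply: le_trans; rewrite ler_nat fsubset_leq_card //.
  apply/fsubsetP => m /sU mS; rewrite in_fset_set; last first.
    by apply: finS; [exact: finite_fset | rewrite set_fsetK].
  by rewrite inE /=; apply/strong_maximal_gt; rewrite ?set_fsetK.
apply: ge_ereal_sup => _ [E /= /andP[cE0 cEoo] <-].
have fE : finite_set E.
  by apply: contrapT => iE; move: cEoo; rewrite /counting asboolF.
move: cE0; rewrite /counting (asboolT fE) lte_fin ltr0n /= => E0.
set S := [set m | _].
have bU (U : {fset 'rV[int]_n}) : [set` U] `<=` S ->
    #|` U|%:R <= c * #|` fset_set E|%:R.
  by move=> US; apply: bc => m mU; apply/strong_maximal_gt => //; exact: US.
(* Otherwise [S] would have finite subsets larger than [bU] allows. *)
have fS : finite_set S.
  apply: contrapT => iS.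
  have [U US Uc] := infinite_set_fset (Num.truncn (c * #|` fset_set E|%:R)).+1 iS.
  have := le_lt_trans (bU U US) (truncnS_gt _).
  by rewrite ltr_nat ltnNge Uc.
rewrite (asboolT fS) -EFinM lee_fin mulrC ler_pdivrMr ?ltr0n //.
by apply: bU; rewrite fset_setK.
Qed.

End Transfer.

(** * Finiteness, monotonicity and local Hoelder continuity *)

Section Regularity.
Variables (R : realType) (n : nat).
Implicit Types (a b c : R).

Notation T a := (fine (tauberian_const n a)).

Lemma strong_bound_ge1 a c : a < 1 -> strong_bound n a c -> 1 <= c.
Proof.
move=> a1 /(_ [fset 0]%fset [fset 0]%fset); rewrite !cardfs1 mulr1; apply=> m.
exact: strong_superlevel_self.
Qed.

Lemma strong_bound_le a b c : a <= b -> strong_bound n a c -> strong_bound n b c.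
Proof.
move=> ab bc F U sU; apply: bc => m /sU[l [u [mb lu d]]].
exists l, u; split=> //; apply: le_lt_trans d.
by rewrite ler_wpM2r ?ler0n.
Qed.

Lemma tauberian_const_fin_num a : 0 < a < 1 -> tauberian_const n a \is a fin_num.
Proof.
move=> /andP[a0 a1].
have [c c0 bc] := tauberian_bound_exists (enum 'I_n) a0 (ltW a1).
have Tc : (tauberian_const n a <= c%:E)%E by apply/tauberian_const_le.
case TE : (tauberian_const n a) Tc => [r| |] //.
(* The value [-oo] would make 0 a bound, although every bound is at least 1. *)
have [|_ b0] := (tauberian_const_le n 0 a0).1; first by rewrite TE leNye.
by have := strong_bound_ge1 a1 b0; rewrite ler10.
Qed.

Lemma strong_bound_tauberian a : 0 < a < 1 -> strong_bound n a (T a).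
Proof.
move=> a01; have /andP[a0 _] := a01.
have [|_ //] := (tauberian_const_le n (T a) a0).1.
by rewrite fineK ?tauberian_const_fin_num.
Qed.

Lemma tauberian_le_bound a c : 0 < a < 1 -> strong_bound n a c -> T a <= c.
Proof.
move=> a01 bc; have /andP[a0 a1] := a01.
rewrite -lee_fin fineK ?tauberian_const_fin_num //; apply/tauberian_const_le => //.
by split=> //; apply: le_trans ler01 _; exact: strong_bound_ge1 bc.
Qed.

Lemma tauberian_ge1 a : 0 < a < 1 -> 1 <= T a.
Proof.
move=> a01; have /andP[_ a1] := a01.
exact: strong_bound_ge1 a1 (strong_bound_tauberian a01).
Qed.

Lemma tauberian_nonincreasing a b : 0 < a -> a <= b -> b < 1 -> T b <= T a.
Proof.
move=> a0 ab b1; apply: tauberian_le_bound; first by rewrite b1 (lt_le_trans a0).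
apply: (strong_bound_le ab); apply: strong_bound_tauberian.
by rewrite a0 (le_lt_trans ab).
Qed.

(* Dilation with [k / N] between [x] and [2 x], where [x = (b - a) / (1 - a)]. *)
Lemma tauberian_increment a b : (0 < n)%N -> 0 < a -> a < b -> b < 1 ->
  T a - T b <= 2 * T a ^+ 2 / (1 - a) * (b - a).
Proof.
move=> n0 a0 ab b1; have i : 'I_n := Ordinal n0.
have a01 : 0 < a < 1 by apply/andP; split; lra.
have b01 : 0 < b < 1 by apply/andP; split; lra.
(* The ratio [d] for which [a + d * (1 - a)] is exactly [b]; the dilation needs [k / N] strictly
   above it. *)
pose x := (b - a) / (1 - a).
have xE : b - a = x * (1 - a) by rewrite /x divfK // lt0r_neq0 //; lra.
have x0 : 0 < x by rewrite divr_gt0; lra.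
have x1 : x < 1 by rewrite ltr_pdivrMr; lra.
(* [N > 1 / x] gives [x * N > 1], so that [x * N < k <= x * N + 1 <= 2 * (x * N)]; [k <= N] follows
   from [x < 1]. *)
pose N := (Num.truncn x^-1).+1; pose k := (Num.truncn (x * N%:R)).+1.
have xN : 1 < x * N%:R by rewrite -ltr_pdivrMl // mulr1 truncnS_gt.
have xN0 : 0 <= x * N%:R by lra.
have N0 : 0 < N%:R :> R by rewrite ltr0n.
have kN : (k <= N)%N by rewrite /k truncn_lt_nat // -[ltRHS]mul1r ltr_pM2r.
have /andP[k1 k2] := truncn_itv xN0; rewrite -/k in k2.
have kE : k%:R = (Num.truncn (x * N%:R))%:R + 1 :> R by rewrite natr1.
have k3 : k%:R <= 2 * (x * N%:R) by lra.
have kx : b * N%:R < a * N%:R + k%:R * (1 - a).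
  by rewrite -ltrBlDl -mulrBl xE mulrAC ltr_pM2r //; lra.
have d0 : 0 <= k%:R / N%:R :> R by rewrite divr_ge0 ?ler0n.
have d2 : k%:R / N%:R <= 2 * x by rewrite ler_pdivrMr // -mulrA.
have cE (t : R) : 2 * t ^+ 2 / (1 - a) * (b - a) = 2 * x * t ^+ 2.
  by rewrite /x; ring.
rewrite {}cE.
have a1 : a < 1 := lt_trans ab b1.
have arith (d A B : R) : 0 <= d -> d <= 2 * x -> 1 <= A -> B <= A -> 1 <= B ->
    A <= B * (1 + d * (A - 1)) -> A - B <= 2 * x * A ^+ 2.
  move=> dge0 dle A1 BA B1 le1.
  apply: (@le_trans _ _ (d * A ^+ 2)); last by rewrite ler_wpM2r // sqr_ge0.
  have : B * (A - 1) <= A ^+ 2 by nra.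
  by move=> /(ler_wpM2l dge0); lra.
have Tb1 := tauberian_ge1 b01.
have le1 := tauberian_le_bound a01 (strong_bound_dilate i (ltn0Sn _ : (0 < N)%N)
  kN (le_trans ler01 Tb1) a1 kx
  (strong_bound_tauberian a01) (strong_bound_tauberian b01)).
exact: (arith _ _ _ d0 d2 (tauberian_ge1 a01)
  (tauberian_nonincreasing a0 (ltW ab) b1) Tb1 le1).
Qed.

(** By monotonicity the increment bound is uniform on [K]: [T] is largest at the minimum [q] of [K],
    and [1 / (1 - a)] at its maximum [r]. *)
Lemma tauberian_locally_hoelder (p : R) : (0 < n)%N -> p <= 1 ->
  locally_hoelder p `]0, 1[ (fun a => T a).
Proof.
move=> n0 p1 K cK K01.
have [->|/set0P K0] := eqVneq K set0; first by exists 0 => a b [].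
have cid A : {within A, continuous (@id R)}.
  by apply: continuous_subspaceT => y; exact: cvg_id.
have [q qK qmin] := compact_EVT_min K0 cK (cid K).
have [r rK rmax] := compact_EVT_max K0 cK (cid K).
have /= := K01 _ (set_mem qK); rewrite in_itv /= => /andP[q0 q1].
have /= := K01 _ (set_mem rK); rewrite in_itv /= => /andP[r0 r1].
pose c := 2 * T q ^+ 2 / (1 - r); exists c.
have c0 : 0 <= c.
  by apply: divr_ge0; rewrite ?subr_ge0 ?(ltW r1) // mulr_ge0 // sqr_ge0.
suff H a b : K a -> K b -> a <= b -> `|T a - T b| <= c * `|a - b| `^ p.
  move=> a b Ka Kb; have [ab|/ltW ba] := leP a b; first exact: H.
  by rewrite distrC (distrC a b); exact: H.
move=> Ka Kb; rewrite le_eqVlt => /predU1P[->|ab].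
  by rewrite subrr normr0 mulr_ge0 ?powR_ge0.
have /= := K01 _ Ka; rewrite in_itv /= => a01; have /andP[a0 a1] := a01.
have /= := K01 _ Kb; rewrite in_itv /= => /andP[b0 b1].
have qa : q <= a := qmin a (mem_set Ka).
have ar : a <= r := rmax a (mem_set Ka).
have sq (A B : R) : 1 <= A -> A <= B -> 2 * A ^+ 2 <= 2 * B ^+ 2 by nra.
have Tab := tauberian_nonincreasing a0 (ltW ab) b1.
rewrite ger0_norm; last by rewrite subr_ge0.
rewrite distrC gtr0_norm; last by rewrite subr_gt0.
have cT : 2 * T a ^+ 2 / (1 - a) <= c.
  apply: ler_pM; first by rewrite mulr_ge0 ?sqr_ge0.
  - by rewrite invr_ge0 subr_ge0 ltW.
  - by apply: sq; [exact: tauberian_ge1 | exact: tauberian_nonincreasing q0 qa a1].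
  - by rewrite lef_pV2 ?posrE ?subr_gt0 // lerB.
apply: (@le_trans _ _ (c * (b - a))).
  apply: le_trans (tauberian_increment n0 a0 ab b1) _.
  by rewrite ler_wpM2r // subr_ge0 ltW.
(* Since [0 < b - a <= 1] and [p <= 1], the Lipschitz bound implies the Hoelder bound. *)
rewrite ler_wpM2l // -[leLHS]powRr1; last by rewrite subr_ge0 ltW.
apply: ger_powR => //; rewrite subr_gt0 ab /= lerBlDl.
by rewrite (le_trans (ltW b1)) // lerDr ltW.
Qed.

End Regularity.

(** * The exact constant in dimension one *)

Section DimensionOne.
Variable R : realType.
Implicit Types (a c : R) (F : {fset 'rV[int]_1}).

Definition segment (p : int) (k : nat) : {fset 'rV[int]_1} :=
  box (const_mx p) (const_mx (p + k%:Z - 1)).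

Lemma in_segment p k x : (x \in segment p k) = (p <= x 0 0 < p + k%:Z).
Proof.
rewrite in_box; apply/forallP/idP => [/(_ 0)|xp i].
  by rewrite !mxE lerBrDr lezD1.
by rewrite (ord1 i) !mxE lerBrDr lezD1.
Qed.

Lemma card_segment p k : #|` segment p k| = k.
Proof.
have -> : segment p k =
    [fset const_mx (p + Posz (nat_of_ord t))%R | t in 'I_k]%fset.
  apply/fsetP => x; rewrite in_segment; apply/idP/imfsetP => /= [px|[t _ ->]].
    have [px1 px2] := andP px.
    have tk : (`|(x 0 0 - p)%R| < k)%N.
      by rewrite -ltz_nat gez0_abs ?subr_ge0 // ltrBlDl.
    exists (Ordinal tk) => //=; apply/rowP => i; rewrite (ord1 i) mxE.
    by rewrite gez0_abs ?subr_ge0 // addrC subrK.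
  by rewrite mxE lerDl ltrD2l ltz_nat ltn_ord.
rewrite card_imfset /=; first by rewrite -cardE card_ord.
move=> t t' /rowP/(_ 0); rewrite !mxE => /addrI[].
exact: val_inj.
Qed.

(** A segment of [N] points extended by [L] on one side still has density above [a]; using both
    sides, the superlevel set contains [N + 2 * L] points. *)
Lemma strong_bound_segment a c (N L : nat) : 0 < a -> a * (N + L)%:R < N%:R ->
  strong_bound 1 a c -> (N + L.*2)%:R <= c * N%:R.
Proof.
move=> a0 aNL bc.
rewrite -[in leRHS](card_segment 0 N) -(card_segment (- L%:Z) (N + L.*2)).
apply: bc => x; rewrite in_segment => xL; apply/strong_superlevelP.
have [x0|x0] := leP 0 (x 0 0).
  exists (const_mx 0), (const_mx (0 + (N + L)%N%:Z - 1)).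
  rewrite -/(segment 0 (N + L)).
  split; first by rewrite in_segment; move: (x 0 0 : int) xL x0 => t; lia.
  rewrite (fsetIidPr _) ?card_segment //.
  by apply/fsubsetP => y; rewrite !in_segment; move: (y 0 0 : int) => t; lia.
exists (const_mx (- L%:Z)), (const_mx (- L%:Z + (N + L)%N%:Z - 1)).
rewrite -/(segment (- L%:Z) (N + L)).
split; first by rewrite in_segment; move: (x 0 0 : int) xL x0 => t; lia.
rewrite (fsetIidPr _) ?card_segment //.
by apply/fsubsetP => y; rewrite !in_segment; move: (y 0 0 : int) => t; lia.
Qed.

Lemma strong_bound1_ge a c : 0 < a < 1 -> strong_bound 1 a c -> 2 / a - 1 <= c.
Proof.
move=> /andP[a0 a1] bc; rewrite leNgt; apply/negP => ca.
pose d := 2 / a - 1 - c; have d0 : 0 < d by rewrite subr_gt0.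
(* Rounding costs at most 4: [N + 2 * L >= N + 2 * y - 4 = c * N + N * d - 4], which exceeds [c * N]
   once [N * d > 4]. *)
pose N := (Num.truncn (4 / d)).+1.
have Nd : 4 < N%:R * d by rewrite -ltr_pdivrMr // truncnS_gt.
have N0 : 0 < N%:R :> R by rewrite ltr0n.
pose y := N%:R / a - N%:R.
have yE : a * (N%:R + y) = N%:R by rewrite /y addrC subrK mulrC divfK // gt_eqF.
have y0 : 0 < y.
  by rewrite subr_gt0 ltr_pdivlMr // -[ltRHS]mulr1 ltr_pM2l.
(* The predecessor keeps [L < y] strict even when [y] is an integer. *)
pose L := (Num.truncn y).-1.
have /andP[y1 y2] := truncn_itv (ltW y0).
have Ly : L%:R < y /\ y <= L%:R + 2.
  rewrite /L; case: (Num.truncn y) y1 y2 => [_|M] /=; first by split=> //; lra.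
  by rewrite -!natr1; split; lra.
have [Ly1 Ly2] := Ly.
have aNL : a * (N + L)%:R < N%:R by rewrite -yE ltr_pM2l // natrD ltrD2l.
have := strong_bound_segment a0 aNL bc.
have -> : (N + L.*2)%:R = N%:R + 2 * L%:R :> R by rewrite natrD -muln2 natrM mulrC.
have dE : N%:R * d = N%:R + 2 * y - c * N%:R.
  by rewrite /d /y; field; rewrite gt_eqF.
by lra.
Qed.

Lemma strong_bound1 a : 0 < a < 1 -> strong_bound 1 a (2 / a - 1).
Proof.
move=> /andP[a0 a1] F U sU.
apply: (tauberian_bound_line (i := ord0) a0 (ltW a1)) => m /sU[l [u [mb _ d]]].
by exists l, u; split=> // j; rewrite inE (ord1 j) eqxx.
Qed.

Lemma tauberian_const1 a : 0 < a < 1 -> tauberian_const 1 a = (2 / a - 1)%:E.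
Proof.
move=> a01; rewrite -[LHS]fineK ?tauberian_const_fin_num //; congr EFin.
apply/le_anti/andP; split.
  by apply: tauberian_le_bound => //; exact: strong_bound1.
by apply: strong_bound1_ge => //; exact: strong_bound_tauberian.
Qed.

(** This shape covers [2 / y - 1] at [k = 0] and, with [e = 0], all of its derivatives. *)
Lemma is_derive_inv_pow (k : nat) (b e x : R) : x != 0 ->
  is_derive x 1 (fun y : R => b * y^-1 ^+ k.+1 + e)
    (- (b * k.+1%:R) * x^-1 ^+ k.+2).
Proof.
move=> x0.
have dV : is_derive x (1 : R) (fun y : R => y^-1) (- x ^- 2 *: 1).
  exact: is_deriveV.
have dX := is_deriveX k.+1 dV.
have dZ := is_deriveZ b dX.
have dC := is_derive_cst e x (1 : R).
have dS := is_deriveD dZ dC.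
have <- : b \*: ((fun y : R => y^-1) ^+ k.+1) + cst e =
    (fun y : R => b * y^-1 ^+ k.+1 + e).
  by apply/funext => y; rewrite fctE exprfctE.
apply: is_derive_eq dS _.
rewrite addr0 /GRing.scale /= mulr1 -exprVn [_ ^+ k.+2]exprS [_ ^+ k.+1]exprS.
by ring.
Qed.

Lemma smooth_on_inv (g : R -> R) (b e : R) :
  (forall x, x \in `]0, 1[ -> g x = b / x + e) -> smooth_on `]0, 1[ g.
Proof.
move=> gE k.
(* Derivatives are local, so an explicit formula on the open interval passes from one order to the
   next. *)
suff [b' [e' gkE]] : exists b' e', forall x, x \in `]0, 1[ ->
    (g^`(k))%classic x = b' * x^-1 ^+ k.+1 + e'.
  move=> x x01; have x0 : x != 0.
    by move: x01; rewrite /= in_itv /= => /andP[/gt_eqF->].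
  have := is_derive_inv_pow k b' e' x0.
  move/(@near_eq_is_derive _ _ _ _ (g^`(k))%classic) => [|//].
  by near=> y; rewrite gkE //; near: y; exact: near_in_itvoo.
elim: k => [|k [b' [e' gkE]]].
  by exists b, e => x; rewrite derive1n0 expr1; exact: gE.
exists (- (b' * k.+1%:R)), 0 => x x01; rewrite addr0 derive1nS derive1E.
have x0 : x != 0 by move: x01; rewrite in_itv /= => /andP[/gt_eqF->].
have := is_derive_inv_pow k b' e' x0.
move/(@near_eq_is_derive _ _ _ _ (g^`(k))%classic) => h.
apply: derive_val; apply: h.
by near=> y; rewrite gkE //; near: y; exact: near_in_itvoo.
Unshelve. all: by end_near.
Qed.

End DimensionOne.

Theorem corollary1 (R : realType) :
  (forall n : nat, (2 <= n)%N ->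
    (forall alpha : R, 0 < alpha < 1 ->
       tauberian_const n alpha \is a fin_num) /\
    locally_hoelder (n%:R^-1) `]0, 1[
      (fun alpha : R => fine (tauberian_const n alpha))) /\
  ((forall alpha : R, 0 < alpha < 1 ->
      tauberian_const 1 alpha = (2 / alpha - 1)%:E) /\
   smooth_on `]0, 1[ (fun alpha : R => fine (tauberian_const 1 alpha))).
Proof.
split=> [n n2|].
  split=> [alpha|]; first exact: tauberian_const_fin_num.
  have n0 : (0 < n)%N := ltnW n2.
  by apply: tauberian_locally_hoelder; rewrite // invf_le1 ?ltr0n // ler1n.
split=> [alpha|]; first exact: tauberian_const1.
apply: (@smooth_on_inv _ _ 2 (-1)) => x; rewrite in_itv /= => x01.
by rewrite tauberian_const1.
Qed.
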